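(* Let $A\in\mathbb{R}^{m\times n}$, $B\in\mathbb{R}^{n\times m}$, $b,f\in\mathbb{R}^m$, $c,g\in\mathbb{R}^n$ all be nonzero, and let $\lambda,\mu\in\mathbb{R}$ (possibly zero). Let $k\ge 2$ and suppose that the simultaneous biorthogonal tridiagonal reduction process applied to $(A,B,b,c,f,g)$ does not break down up to index $k$. Let $\alpha_i,\theta_i$ ($1\le i\le k-1$) and $\beta_i,\gamma_i,\delta_i,\eta_i$ ($2\le i\le k$) be the scalars it produces, and set $$E_{i,i-1}=\begin{bmatrix}0&\beta_i\\ \delta_i&0\end{bmatrix},\qquad E_{ii}=\begin{bmatrix}\lambda&\alpha_i\\ \theta_i&\mu\end{bmatrix},\qquad E_{i-1,i}=\begin{bmatrix}0&\gamma_i\\ \eta_i&0\end{bmatrix}.$$ Then the block tridiagonal matrix $$H_{k-1,k}=\begin{bmatrix}E_{11}&E_{12}&&&\\ E_{21}&E_{22}&\ddots&&\\ &\ddots&\ddots&E_{k-2,k-1}&\\ &&E_{k-1,k-2}&E_{k-1,k-1}&E_{k-1,k}\end{bmatrix}\in\mathbb{R}^{(2k-2)\times 2k}$$ (with $k-1$ block rows and $k$ block columns of $2\times2$ blocks, all blocks not of the form $E_{i,j}$ with $|i-j|\le 1$ being zero) has full row rank.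
   Context: The simultaneous biorthogonal tridiagonal reduction process (in exact arithmetic), with input nonzero $A\in\mathbb{R}^{m\times n}$, $B\in\mathbb{R}^{n\times m}$, $b,f\in\mathbb{R}^m$, $c,g\in\mathbb{R}^n$, is the following. Set $p_0=q_0=0\in\mathbb{R}^m$, $u_0=v_0=0\in\mathbb{R}^n$. Put $\tilde p_1=f$, $\tilde q_1=b$, $\tilde u_1=c$, $\tilde v_1=g$, and $\eta_1p_1=\tilde p_1$, $\beta_1q_1=\tilde q_1$, $\delta_1u_1=\tilde u_1$, $\gamma_1v_1=\tilde v_1$, where the real scalars $\eta_1,\beta_1$ are chosen so that $p_1^\top q_1=1$ and $\delta_1,\gamma_1$ so that $u_1^\top v_1=1$. For $i=1,2,\dots$: - $\alpha_i=p_i^\top A u_i$, $\theta_i=v_i^\top B q_i$; - $\eta_{i+1}p_{i+1}=\tilde p_{i+1}:=B^\top v_i-\delta_i p_{i-1}-\theta_i p_i$; - $\beta_{i+1}q_{i+1}=\tilde q_{i+1}:=A u_i-\gamma_i q_{i-1}-\alpha_i q_i$; - $\delta_{i+1}u_{i+1}=\tilde u_{i+1}:=B q_i-\eta_i u_{i-1}-\theta_i u_i$; - $\gamma_{i+1}v_{i+1}=\tilde v_{i+1}:=A^\top p_i-\beta_i v_{i-1}-\alpha_i v_i$; where the real scalars $\eta_{i+1},\beta_{i+1}$ are chosen so that $p_{i+1}^\top q_{i+1}=1$, and $\delta_{i+1},\gamma_{i+1}$ so that $u_{i+1}^\top v_{i+1}=1$. That is, the scalars are nonzero reals with $\eta_j\beta_j=\tilde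 p_j^\top\tilde q_j$ and $\delta_j\gamma_j=\tilde u_j^\top\tilde v_j$ (for example $\eta_j=|\tilde p_j^\top\tilde q_j|^{1/2}$, $\beta_j=\tilde p_j^\top\tilde q_j/\eta_j$, $\delta_j=|\tilde u_j^\top\tilde v_j|^{1/2}$, $\gamma_j=\tilde u_j^\top\tilde v_j/\delta_j$). The process does not break down up to index $N$ if $\tilde p_j^\top\tilde q_j\neq0$ and $\tilde u_j^\top\tilde v_j\ne0$ for all $1\le j\le N$, so that all vectors with index at most $N$ and the corresponding nonzero scaling scalars are defined. *)

(* Defs.v *)
From HB Require Import structures.
From mathcomp Require Import all_boot all_order all_algebra.
From mathcomp Require Import reals.

Set Implicit Arguments.
Unset Strict Implicit.
Unset Printing Implicit Defensive.

Local Open Scope ring_scope.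

Definition dot (R : realType) (d : nat) (x y : 'cV[R]_d) : R :=
  (x^T *m y) 0 0.

(* Names ending in t are the unscaled (tilde) vectors. All sequences are total;
   the predicates below constrain them only up to the index reached. *)
Record trace (R : realType) (m n : nat) := Trace {
  p : nat -> 'cV[R]_m;
  q : nat -> 'cV[R]_m;
  u : nat -> 'cV[R]_n;
  v : nat -> 'cV[R]_n;
  pt : nat -> 'cV[R]_m;
  qt : nat -> 'cV[R]_m;
  ut : nat -> 'cV[R]_n;
  vt : nat -> 'cV[R]_n;
  alpha : nat -> R;
  theta : nat -> R;
  beta : nat -> R;
  gamma : nat -> R;
  delta : nat -> R;
  eta : nat -> R
}.

(* The index i + 1 of the tilde vectors is at most N, hence i < N in the
   recurrences. The scaling scalars are not fixed by a formula: any choice that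
   normalizes the pairs (p_j, q_j) and (u_j, v_j) is allowed. *)
Record tridiag_process (R : realType) (m n : nat)
    (A : 'M[R]_(m, n)) (B : 'M[R]_(n, m)) (b : 'cV[R]_m) (c : 'cV[R]_n)
    (f : 'cV[R]_m) (g : 'cV[R]_n) (N : nat) (s : trace R m n) : Prop := {
  process_p0 : p s 0%N = 0;
  process_q0 : q s 0%N = 0;
  process_u0 : u s 0%N = 0;
  process_v0 : v s 0%N = 0;
  process_pt1 : pt s 1%N = f;
  process_qt1 : qt s 1%N = b;
  process_ut1 : ut s 1%N = c;
  process_vt1 : vt s 1%N = g;
  process_scale_p : forall j, (1 <= j <= N)%N -> eta s j *: p s j = pt s j;
  process_scale_q : forall j, (1 <= j <= N)%N -> beta s j *: q s j = qt s j;
  process_scale_u : forall j, (1 <= j <= N)%N -> delta s j *: u s j = ut s j;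
  process_scale_v : forall j, (1 <= j <= N)%N -> gamma s j *: v s j = vt s j;
  process_pq : forall j, (1 <= j <= N)%N -> dot (p s j) (q s j) = 1;
  process_uv : forall j, (1 <= j <= N)%N -> dot (u s j) (v s j) = 1;
  process_alpha : forall i, (1 <= i <= N)%N ->
    alpha s i = dot (p s i) (A *m u s i);
  process_theta : forall i, (1 <= i <= N)%N ->
    theta s i = dot (v s i) (B *m q s i);
  process_pt : forall i, (1 <= i < N)%N ->
    pt s i.+1 = B^T *m v s i - delta s i *: p s i.-1 - theta s i *: p s i;
  process_qt : forall i, (1 <= i < N)%N ->
    qt s i.+1 = A *m u s i - gamma s i *: q s i.-1 - alpha s i *: q s i;
  process_ut : forall i, (1 <= i < N)%N ->
    ut s i.+1 = B *m q s i - eta s i *: u s i.-1 - theta s i *: u s i;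
  process_vt : forall i, (1 <= i < N)%N ->
    vt s i.+1 = A^T *m p s i - beta s i *: v s i.-1 - alpha s i *: v s i
}.

(* Together with the scaling equations this forces the scaling scalars of index
   1, ..., N to be nonzero: dot (pt j) (qt j) = eta j * beta j and
   dot (ut j) (vt j) = delta j * gamma j. *)
Definition no_breakdown (R : realType) (m n : nat) (N : nat)
    (s : trace R m n) : Prop :=
  forall j, (1 <= j <= N)%N ->
    dot (pt s j) (qt s j) != 0 /\ dot (ut s j) (vt s j) != 0.

(* [ a11 a12 ; a21 a22 ] *)
Definition mx22 (R : realType) (a11 a12 a21 a22 : R) : 'M[R]_2 :=
  \matrix_(i < 2, j < 2)
    if i == 0 then (if j == 0 then a11 else a12)
    else (if j == 0 then a21 else a22).

(* The block indices i, j start at 1. *)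
Definition E_block (R : realType) (m n : nat) (lambda mu : R)
    (s : trace R m n) (i j : nat) : 'M[R]_2 :=
  if i == j then mx22 lambda (alpha s i) (theta s i) mu
  else if i == j.+1 then mx22 0 (beta s i) (delta s i) 0
  else if j == i.+1 then mx22 0 (gamma s j) (eta s j) 0
  else 0.

(* k - 1 block rows and k block columns; the dimensions are sums of block sizes
   and equal 2 (k - 1) and 2 k. *)
Definition H_matrix (R : realType) (m n : nat) (lambda mu : R)
    (s : trace R m n) (k : nat) :
    'M[R]_(\sum_(i < k.-1) 2, \sum_(j < k) 2) :=
  \mxblock_(i < k.-1, j < k) E_block lambda mu s i.+1 j.+1.

(* Main.v *)
Require Import Defs.
From HB Require Import structures.
From mathcomp Require Import all_boot all_order all_algebra.
From mathcomp Require Import reals.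

(** Deleting the first block column of the matrix leaves a square block lower
    triangular matrix whose diagonal blocks are the superdiagonal blocks
    [0 gamma_i; eta_i 0], for i = 2, ..., k. Since the process does not break
    down, eta_i beta_i and delta_i gamma_i are nonzero, so these blocks are
    invertible ([process_scalars_neq0], [row_free_mx22_anti]). A left null
    vector of a matrix with such a shape vanishes, as back substitution from
    the last block shows ([row_free_mxblock_echelon]). The diagonal and
    subdiagonal blocks, in particular lambda and mu, play no role. *)

Set Implicit Arguments.
Unset Strict Implicit.
Unset Printing Implicit Defensive.

Import GRing.Theory.

Local Open Scope ring_scope.

(** The function [phi] selects a pivot block column for each block row: the
    pivot block has full row rank and every block above it is zero. *)
Lemma row_free_mxblock_echelon (F : fieldType) (r l : nat)
    (d : 'I_r -> nat) (e : 'I_l -> nat)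
    (M : forall i j, 'M[F]_(d i, e j)) (phi : 'I_r -> 'I_l) :
  (forall i, row_free (M i (phi i))) ->
  (forall i i' : 'I_r, (i' < i)%N -> M i' (phi i) = 0) ->
  row_free (\mxblock_(i, j) M i j).
Proof.
move=> piv above; apply/inj_row_free => x.
rewrite -(submxrowK x) mul_mxrow_mxblock => xM0.
suff x0 i : submxrow x i = 0 by rewrite -[RHS]mxrow0; apply/eq_mxrowP.
(* Strong induction on r - i, that is, from the last block upwards. *)
have [h] := ubnP (r - i); elim: h i => // h IHh i le_h.
apply: (row_free_inj (piv i)); rewrite mul0mx.
have := congr1 (fun y => submxrow y (phi i)) xM0.
rewrite -[in submxrow 0]mxrow0 !mxrowK (bigD1 i) //=.
rewrite big1 ?addr0 // => i' ne_i'i.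
have [lt_i'i | ] := ltnP i' i; first by rewrite above // mulmx0.
rewrite leq_eqVlt eq_sym (negPf ne_i'i : (i' == i :> nat) = false) /= => lt_ii'.
rewrite IHh ?mul0mx //.
rewrite ltnS in le_h; apply: leq_trans le_h; exact: ltn_sub2l.
Qed.

Lemma row_free_mx22_anti (R : realType) (x y : R) :
  x != 0 -> y != 0 -> row_free (mx22 0 x y 0).
Proof.
move=> x0 y0; rewrite row_free_unit unitmxE (expand_det_row _ 0).
rewrite !big_ord_recl big_ord0 /cofactor !det_mx11 !mxE /=.
by rewrite !mul0r add0r addr0 expr1 mulN1r mulrN unitfE oppr_eq0 mulf_neq0.
Qed.

Lemma dotZ (R : realType) (d : nat) (a b : R) (x y : 'cV[R]_d) :
  dot (a *: x) (b *: y) = a * b * dot x y.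
Proof.
by rewrite /dot [(a *: x)^T]linearZ /= -scalemxAl -scalemxAr !mxE mulrA.
Qed.

Lemma process_scalars_neq0 (R : realType) (m n : nat)
    (A : 'M[R]_(m, n)) (B : 'M[R]_(n, m)) (b f : 'cV[R]_m) (c g : 'cV[R]_n)
    (N : nat) (s : trace R m n) :
  tridiag_process A B b c f g N s -> no_breakdown N s ->
  forall j, (1 <= j <= N)%N -> gamma s j != 0 /\ Defs.eta s j != 0.
Proof.
move=> proc nobreak j jN; have [] := nobreak j jN.
rewrite -(process_scale_p proc jN) -(process_scale_q proc jN) dotZ.
rewrite -(process_scale_u proc jN) -(process_scale_v proc jN) dotZ.
by rewrite !mulf_eq0 !negb_or => /andP[/andP[-> _] _] /andP[/andP[_ ->] _].
Qed.

Theorem proposition3 (R : realType) (m n : nat)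
    (A : 'M[R]_(m, n)) (B : 'M[R]_(n, m)) (b f : 'cV[R]_m) (c g : 'cV[R]_n)
    (lambda mu : R) (k : nat) (s : trace R m n)
    (hA : A != 0) (hB : B != 0) (hb : b != 0) (hf : f != 0)
    (hc : c != 0) (hg : g != 0) (hk : (2 <= k)%N)
    (hprocess : tridiag_process A B b c f g k s)
    (hbreak : no_breakdown k s) :
  row_free (H_matrix lambda mu s k).
Proof.
case: k hk hprocess hbreak => // k _ hprocess hbreak.
(* The pivot of each block row is the block right after the diagonal one. *)
apply: (row_free_mxblock_echelon (phi := fun i : 'I_k => lift ord0 i)).
  move=> i; rewrite /E_block lift0 eqn_leq ltnn andbF.
  rewrite ltn_eqF ?eqxx; last by rewrite ltnS ltnW.
  have [] := process_scalars_neq0 hprocess hbreak (j := i.+2).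
    by rewrite /= ltnS ltn_ord.
  exact: row_free_mx22_anti.
move=> i i' lt_i'i; rewrite /E_block lift0 !eqSS.
have [lt1 lt2] : (i' < i.+1)%N /\ (i' < i.+2)%N.
  by split; apply: (ltn_trans lt_i'i).
by rewrite (ltn_eqF lt1) (ltn_eqF lt2) (gtn_eqF lt_i'i).
Qed.
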